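(* Consider the complete Boolean algebra $$\mathbf{B}=\mathbf{2}^{\mathbf{\Omega}}=\prod_{S\in\mathbf{\Omega}}\{0,1\}.$$ Then there are surjective geometric morphisms $$\mathrm{Sh}(\mathbf{B})\twoheadrightarrow \mathrm{Sh}(\mathbb{S})\twoheadrightarrow\widehat{\mathbf{C}}.$$ That is, $\mathbf{B}$ is a Barr cover of $\widehat{\mathbf{C}}$.
   Context: $\mathbb{N}^\times_+$ is the multiplicative monoid of strictly positive integers; $\mathbf{C}$ is the one-object category with endomorphism monoid $\mathbb{N}^\times_+$; $\widehat{\mathbf{C}}$ is its presheaf topos, i.e. the category of sets with a right $\mathbb{N}^\times_+$-action (the underlying topos of the arithmetic site). $\mathbf{\Omega}$ is the set of all ideals of $\mathbb{N}^\times_+$ (subsets, possibly empty, closed under taking multiples), each of the form $\bigcup_i n_i\mathbb{N}^\times_+$. $\mathbb{S}$ is the set of supernatural numbers, i.e. formal products $s=\prod_p p^{s_p}$ over all primes with $s_p\in\mathbb{N}\cup\{\infty\}$, regarded as a topological space with open sets $\{s\in\mathbb{S} : \exists i,\ n_i\mid s\}$ for $\bigcup_i n_i\mathbb{N}^\times_+\in\mathbf{\Omega}$ (divisibility meaning inequality of all exponents). For a complete Boolean algebra $\mathbf{B}$, $\mathrm{Sh}(\mathbf{B})$ is the topos of sheaves on $\mathbf{B}$ viewed as a locale (covers are families whose join is the given element). A Barr cover of a Grothendieck topos $\mathcal{E}$ is a complete Boolean algebra $\mathbf{B}$ with a surjective geometric morphism $\mathrm{Sh}(\mathbf{B})\to\mathcal{E}$.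 *)

(* Defs.v *)
From HB Require Import structures.
From mathcomp Require Import all_boot all_order.
From mathcomp Require Import all_classical.
From mathcomp Require Import topology.

Set Implicit Arguments.
Unset Strict Implicit.
Unset Printing Implicit Defensive.

Local Open Scope classical_set_scope.

Record category := Category {
  Obj :> Type;
  Hom : Obj -> Obj -> Type;
  idc : forall x, Hom x x;
  compc : forall x y z, Hom y z -> Hom x y -> Hom x z;
  compc1 : forall x y (f : Hom x y), compc f (idc x) = f;
  comp1c : forall x y (f : Hom x y), compc (idc y) f = f;
  compcA : forall x y z t (h : Hom z t) (g : Hom y z) (f : Hom x y),
    compc h (compc g f) = compc (compc h g) f
}.

Arguments idc {c} x.
Arguments compc {c x y z} _ _.

Declare Scope cat_scope.
Delimit Scope cat_scope with cat.
Local Open Scope cat_scope.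
Notation "g '**' f" := (compc g f)
  (at level 40, left associativity) : cat_scope.

Definition op_category (C : category) : category := {|
  Obj := Obj C;
  Hom := fun x y => @Hom C y x;
  idc := fun x => @idc C x;
  compc := fun _ _ _ g f => @compc C _ _ _ f g;
  compc1 := fun _ _ f => comp1c f;
  comp1c := fun _ _ f => compc1 f;
  compcA := fun _ _ _ _ h g f => esym (compcA f g h)
|}.

(* With functional extensionality, and equality proof-irrelevant, the types of a
   universe behave as the sets of that universe. *)
Definition set_category : category := {|
  Obj := Type;
  Hom := fun X Y => X -> Y;
  idc := fun X x => x;
  compc := fun _ _ _ g f x => g (f x);
  compc1 := fun _ _ _ => erefl;
  comp1c := fun _ _ _ => erefl;
  compcA := fun _ _ _ _ _ _ _ => erefl
|}.

Record functor (C D : category) := Functor {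
  fobj :> C -> D;
  fmap : forall x y, Hom x y -> Hom (fobj x) (fobj y);
  fmap1 : forall x, fmap (idc x) = idc (fobj x);
  fmapM : forall x y z (g : Hom y z) (f : Hom x y),
    fmap (g ** f) = fmap g ** fmap f
}.

Arguments fmap {C D} f {x y} _ : rename.

Program Definition functor_comp (C D E : category)
    (G : functor D E) (F : functor C D) : functor C E :=
  {| fobj := fun x => G (F x); fmap := fun x y f => fmap G (fmap F f) |}.
Next Obligation. by move=> C D E G F x; rewrite /= !fmap1. Qed.
Next Obligation. by move=> C D E G F x y z g f; rewrite /= !fmapM. Qed.

Record nat_trans (C D : category) (F G : functor C D) := NatTrans {
  ntr :> forall x, Hom (F x) (G x);
  ntr_nat : forall x y (f : Hom x y), ntr y ** fmap F f = fmap G f ** ntr x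
}.

Lemma nat_trans_eq (C D : category) (F G : functor C D) (a b : nat_trans F G) :
  (forall x, a x = b x) -> a = b.
Proof.
case: a b => [a an] [b bn] /= ab.
have {}ab : a = b by apply: functional_extensionality_dep.
by case: _ / ab bn => bn; congr NatTrans; apply: Prop_irrelevance.
Qed.

Program Definition functor_category (C D : category) : category := {|
  Obj := functor C D;
  Hom := @nat_trans C D;
  idc := fun F => {| ntr := fun x => idc (F x) |};
  compc := fun F G H b a => {| ntr := fun x => b x ** a x |}
|}.
Next Obligation. by move=> C D F x y f; rewrite /= comp1c compc1. Qed.
Next Obligation.
by move=> C D F G H b a x y f; rewrite /= -compcA ntr_nat compcA ntr_nat compcA.
Qed.
Next Obligation.
by move=> C D F G a; apply: nat_trans_eq => x /=; rewrite compc1.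
Qed.
Next Obligation.
by move=> C D F G a; apply: nat_trans_eq => x /=; rewrite comp1c.
Qed.
Next Obligation.
by move=> C D F G H K c b a; apply: nat_trans_eq => x /=; rewrite compcA.
Qed.

Definition full_subcategory (C : category) (P : C -> Prop) : category := {|
  Obj := {x : C | P x};
  Hom := fun x y => Hom (sval x) (sval y);
  idc := fun x => idc (sval x);
  compc := fun _ _ _ g f => g ** f;
  compc1 := fun _ _ f => compc1 f;
  comp1c := fun _ _ f => comp1c f;
  compcA := fun _ _ _ _ h g f => compcA h g f
|}.

Definition PSh (C : category) : category :=
  functor_category (op_category C) set_category.

Definition presieve (C : category) (u : C) := forall v : C, Hom v u -> Prop.

(* No closure condition is imposed on the coverings; those of the sites built
   below from spaces and locales are stable under pullback. *)
Record site := Site {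
  site_cat :> category;
  covers : forall u : site_cat, presieve u -> Prop
}.

Definition restrict (C : category) (F : PSh C) (u v : C) (f : Hom v u) :
  fobj F u -> fobj F v := @fmap _ _ F u v f.

Definition matching (C : category) (F : PSh C) (u : C) (A : presieve u)
    (x : forall v (f : Hom v u), A v f -> fobj F v) : Prop :=
  forall v w (f : Hom v u) (g : Hom w u) (Af : A v f) (Ag : A w g)
         t (h : Hom t v) (k : Hom t w),
    f ** h = g ** k -> restrict h (x v f Af) = restrict k (x w g Ag).

Definition is_sheaf (S : site) (F : PSh S) : Prop :=
  forall (u : S) (A : presieve u), covers A ->
  forall x : (forall v (f : Hom v u), A v f -> fobj F v), matching x ->
  exists! s : fobj F u, forall v (f : Hom v u) (Af : A v f),
    restrict f s = x v f Af.

Definition Sh (S : site) : category := full_subcategory (@is_sheaf S).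

Definition is_finite (T : Type) : Prop :=
  exists (n : nat) (e : 'I_n -> T), forall x, exists i, e i = x.

Definition finite_category (J : category) : Prop :=
  is_finite J /\ forall i j : J, is_finite (Hom i j).

Definition is_cone (J C : category) (D : functor J C) (a : C)
    (p : forall j, Hom a (D j)) : Prop :=
  forall i j (u : Hom i j), fmap D u ** p i = p j.

Definition is_limit (J C : category) (D : functor J C) (a : C)
    (p : forall j, Hom a (D j)) : Prop :=
  is_cone p /\
  forall (b : C) (q : forall j, Hom b (D j)), is_cone q ->
  exists! h : Hom b a, forall j, p j ** h = q j.

Definition preserves_finite_limits (C D : category) (F : functor C D) : Prop :=
  forall (J : category) (G : functor J C) (a : C) (p : forall j, Hom a (G j)),
    finite_category J -> is_limit p ->
    is_limit (D := functor_comp F G) (fun j => fmap F (p j)).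

Record adjunction (C D : category) (L : functor C D) (R : functor D C) :=
  Adjunction {
  adj : forall x y, Hom (L x) y -> Hom x (R y);
  adj_inv : forall x y, Hom x (R y) -> Hom (L x) y;
  adjK : forall x y, cancel (@adj x y) (@adj_inv x y);
  adj_invK : forall x y, cancel (@adj_inv x y) (@adj x y);
  adj_nat : forall x x' y y' (f : Hom x' x) (g : Hom y y') (h : Hom (L x) y),
    adj (g ** h ** fmap L f) = fmap R g ** adj h ** f
}.

Record geometric_morphism (E F : category) := GeometricMorphism {
  direct_image : functor E F;
  inverse_image : functor F E;
  gm_adj : adjunction inverse_image direct_image;
  gm_lex : preserves_finite_limits inverse_image
}.

Definition faithful (C D : category) (F : functor C D) : Prop :=
  forall x y (f g : Hom x y), fmap F f = fmap F g -> f = g.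

Definition surjective_gm (E F : category) (f : geometric_morphism E F) : Prop :=
  faithful (inverse_image f).

Section preorder_category.
Variables (T : Type) (le : T -> T -> Prop).
Hypotheses (le_refl : forall x, le x x)
  (le_trans : forall x y z, le y z -> le x y -> le x z).

Definition preorder_category : category := {|
  Obj := T;
  Hom := le;
  idc := le_refl;
  compc := le_trans;
  compc1 := fun _ _ _ => Prop_irrelevance _ _;
  comp1c := fun _ _ _ => Prop_irrelevance _ _;
  compcA := fun _ _ _ _ _ _ _ => Prop_irrelevance _ _
|}.
End preorder_category.

Record opens (X : topologicalType) := Opens {
  open_set :> set X;
  open_setP : open open_set
}.

Definition opens_category (X : topologicalType) : category :=
  @preorder_category (opens X) (fun U V => U `<=` V)
    (fun U => @subset_refl X U) (fun U V W VW UV => subset_trans UV VW).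

Definition space_site (X : topologicalType) : site := {|
  site_cat := opens_category X;
  covers := fun (U : opens X) (A : @presieve (opens_category X) U) =>
    \bigcup_(V in [set V : opens X | exists VU : V `<=` U, A V VU])
      open_set V = open_set U
|}.

HB.mixin Record isCompleteLattice (d : Order.disp_t) T of Order.Lattice d T := {
  has_supremums : forall A : set T, supremums A !=set0
}.

#[short(type="completeBooleanType")]
HB.structure Definition CompleteBoolean (d : Order.disp_t) :=
  { T of Order.CTBDistrLattice d T & isCompleteLattice d T }.

Definition locale_category (d : Order.disp_t) (B : porderType d) : category :=
  @preorder_category B (fun x y => (x <= y)%O)
    (fun x => Order.POrderTheory.lexx x)
    (fun x y z yz xy => Order.POrderTheory.le_trans xy yz).

Definition locale_site (d : Order.disp_t) (B : completeBooleanType d) : site := {|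
  site_cat := locale_category B;
  covers := fun (u : B) (A : @presieve (locale_category B) u) =>
    supremums [set v : B | exists vu : (v <= u)%O, A v vu] u
|}.

Definition barr_cover (d : Order.disp_t) (B : completeBooleanType d)
    (E : category) : Prop :=
  exists f : geometric_morphism (Sh (locale_site B)) E, surjective_gm f.

(* The power of {0,1} indexed by T; its order, copied below from the function
   type, is pointwise. *)
Definition two_power (T : Type) := T -> bool.

Section two_power.
Import Order.TTheory.
Variable T : Type.
Implicit Types f g h : two_power T.

HB.instance Definition _ := Order.Lattice.copy (two_power T) (T -> bool).

Let meetUl :
  left_distributive (@Order.meet _ (two_power T)) (@Order.join _ (two_power T)).
Proof. by move=> f g h; apply/funext => x; apply: meetUl. Qed.

HB.instance Definition _ :=
  Order.Lattice_Meet_isDistrLattice.Build _ (two_power T) meetUl.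

Let bot_le f : ((fun=> false) <= f :> two_power T)%O.
Proof. by apply/lefP => x; apply: le0x. Qed.

Let le_top f : (f <= (fun=> true) :> two_power T)%O.
Proof. by apply/lefP => x; apply: lex1. Qed.

HB.instance Definition _ := Order.hasBottom.Build _ (two_power T) bot_le.
HB.instance Definition _ := Order.hasTop.Build _ (two_power T) le_top.

Let joinxC f : (f `|` (fun x => ~~ f x) = \top :> two_power T)%O.
Proof. by apply/funext => x; apply: orbN. Qed.

Let meetxC f : (f `&` (fun x => ~~ f x) = \bot :> two_power T)%O.
Proof. by apply/funext => x; apply: andbN. Qed.

HB.instance Definition _ :=
  Order.TBDistrLattice_hasComplement.Build _ (two_power T) joinxC meetxC.

Let le_boolE (a b : bool) : (a <= b)%O = (a ==> b).
Proof. by case: a b => [] []. Qed.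

Let has_sup (A : set (two_power T)) : supremums A !=set0.
Proof.
exists (fun x => `[< exists2 f, A f & f x >]); split => [f Af|g gA].
  apply/lefP => x; rewrite le_boolE; apply/implyP => fx.
  by apply/asboolP; exists f.
apply/lefP => x; rewrite le_boolE; apply/implyP => /asboolP[f /gA/lefP/(_ x)].
by rewrite le_boolE => /implyP; apply.
Qed.

HB.instance Definition _ := isCompleteLattice.Build _ (two_power T) has_sup.
End two_power.

Definition posnat := {n : nat | 0 < n}.

HB.instance Definition _ := Choice.on posnat.

Section posnat_monoid.
Implicit Types l m n : posnat.

Let mul_gt0 m n : 0 < val m * val n.
Proof. by rewrite muln_gt0 (valP m) (valP n). Qed.

Definition posnat_mul m n : posnat := exist _ (val m * val n) (mul_gt0 m n).
Definition posnat_one : posnat := exist _ 1 (ltn0Sn 0).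

Let mulA : associative posnat_mul.
Proof. by move=> l m n; apply/val_inj/mulnA. Qed.

Let mulL : left_id posnat_one posnat_mul.
Proof. by move=> n; apply/val_inj/mul1n. Qed.

Let mulR : right_id posnat_one posnat_mul.
Proof. by move=> n; apply/val_inj/muln1. Qed.

HB.instance Definition _ := isMonoid.Build posnat mulA mulL mulR.
End posnat_monoid.

Definition monoid_category (M : monoidType) : category := {|
  Obj := unit;
  Hom := fun _ _ => M;
  idc := fun _ => 1%g;
  compc := fun _ _ _ (n m : M) => (n * m)%g;
  compc1 := fun _ _ (m : M) => mulg1 m;
  comp1c := fun _ _ (m : M) => mul1g m;
  compcA := fun _ _ _ _ (l n m : M) => mulgA l n m
|}.

Record ideal := Ideal {
  ideal_set :> set posnat;
  ideal_mul : forall m n : posnat, ideal_set m -> ideal_set (m * n)%g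
}.

(* None stands for an infinite exponent. *)
Definition exponent := option nat.

Definition le_exponent (e f : exponent) : Prop :=
  match e, f with
  | _, None => True
  | None, Some _ => False
  | Some i, Some j => i <= j
  end.

Definition supernatural := {p : nat | prime p} -> exponent.

Definition supernat_dvd (s t : supernatural) : Prop :=
  forall p, le_exponent (s p) (t p).

Definition supernat_of (n : posnat) : supernatural :=
  fun p => Some (logn (val p) (val n)).

(* An ideal is generated by the family of all its elements, so this is the open
   set attached to any of its families of generators. *)
Definition supernat_open_of (I : ideal) : set supernatural :=
  [set s | exists2 n, ideal_set I n & supernat_dvd (supernat_of n) s].

Definition supernat_open : set_system supernatural := range supernat_open_of.

Section supernat_topology.

Let dvdM m n s : supernat_dvd (supernat_of (m * n)%g) s ->
  supernat_dvd (supernat_of m) s.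
Proof.
move=> mns p; move: (mns p); rewrite /supernat_of /=; case: (s p) => //= e.
by apply: leq_trans; rewrite lognM ?leq_addr ?(valP m) ?(valP n).
Qed.

Let opT : supernat_open setT.
Proof.
exists (@Ideal setT (fun _ _ _ => I)) => //.
rewrite -subTset => s _; exists 1%g => // p.
by rewrite /supernat_of /= logn1; case: (s p).
Qed.

Let opI : setI_closed supernat_open.
Proof.
move=> _ _ [I _ <-] [J _ <-].
have IJ m n : (I `&` J) m -> (I `&` J) (m * n)%g.
  by move=> [Im Jm]; split; apply: ideal_mul.
exists (Ideal IJ) => //; apply/seteqP; split=> s.
  by move=> [n [In Jn] ns]; split; exists n.
move=> [[m Im ms] [n Jn ns]].
have lcm_gt0 : 0 < lcmn (val m) (val n) by rewrite lcmn_gt0 (valP m) (valP n).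
pose l : posnat := exist _ (lcmn (val m) (val n)) lcm_gt0.
have lE (k : posnat) : val k %| val l -> exists k', l = (k * k')%g.
  move=> /dvdnP[q lqk].
  have q_gt0 : 0 < q by case: q lqk (valP l) => // ->.
  by exists (exist _ q q_gt0); apply/val_inj; rewrite /= mulnC -lqk.
exists l => [|p].
  split.
  - by have [k ->] := lE m (dvdn_lcml _ _); apply: ideal_mul.
  - by have [k ->] := lE n (dvdn_lcmr _ _); apply: ideal_mul.
rewrite /supernat_of /= logn_lcm ?(valP m) ?(valP n) //.
by move: (ms p) (ns p); rewrite /supernat_of /=; case: (s p) => //= e;
  rewrite geq_max => -> ->.
Qed.

Let op_bigU (K : Type) (f : K -> set supernatural) :
  (forall k, supernat_open (f k)) -> supernat_open (\bigcup_k f k).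
Proof.
move=> fop.
pose U n := forall s, supernat_dvd (supernat_of n) s -> (\bigcup_k f k) s.
have UM m n : U m -> U (m * n)%g by move=> Um s /dvdM; apply: Um.
exists (@Ideal U UM) => //; apply/seteqP; split=> s.
  by move=> [n Un /Un].
move=> [k _]; have [I _ fk] := fop k; rewrite -fk => -[n In ns].
by exists n => // t nt; exists k => //; rewrite -fk; exists n.
Qed.

HB.instance Definition _ :=
  Choice.copy supernatural ({p : nat | prime p} -> exponent).
HB.instance Definition _ :=
  isOpenTopological.Build supernatural opT opI op_bigU.
End supernat_topology.

(* Main.v *)
From mathcomp Require Import all_boot all_order all_classical topology.
Require Import Defs.

(** Both sheaf toposes are presheaf toposes in disguise, because both sites have
    enough irreducible objects: objects [x] such that every arrow from [x] to a
    covered object factors through a member of the cover. In the space of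
    supernatural numbers these are the opens [dvd_open n], the supernatural
    multiples of a positive integer [n]: such an open has the least element [n],
    and an open set that contains [n] contains every multiple of [n]. In a power
    of the two-element algebra they are the atoms. In both sites every object is
    covered by the irreducible objects below it, and so a sheaf amounts to its
    values at them. The equivalences are [points_unit_iso] and
    [points_counit_iso]; an equivalence gives surjective geometric morphisms in
    both directions ([equivalence_gm], [equivalence_gm_inv]).

    It remains to relate presheaves on three small categories: the discrete
    category of ideals, the positive integers ordered by reverse divisibility,
    and the monoid of positive integers. Sending the principal ideal of [n] to
    [n], and every other ideal to 1, is a functor from the first to the second;
    sending [m %| n] to the quotient [n %/ m] is a functor from the second to the
    third. Both are surjective on objects. Precomposition with such a functor is
    faithful, has the right Kan extension as right adjoint, and preserves limits,
    since these are computed pointwise; so it is the inverse image of a surjective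
    geometric morphism ([precomp_gm]). The three claims follow by composition. *)

Set Implicit Arguments.
Unset Strict Implicit.
Unset Printing Implicit Defensive.

Local Open Scope classical_set_scope.
Local Open Scope cat_scope.

(** * Adjunctions and geometric morphisms *)

Section adjunction_theory.
Variables (C D : category) (L : functor C D) (R : functor D C).
Variable A : adjunction L R.

Lemma adj_natl x y y' (g : Hom y y') (h : Hom (L x) y) :
  adj A (g ** h) = fmap R g ** adj A h.
Proof. by rewrite -[RHS]compc1 -adj_nat fmap1 compc1. Qed.

Lemma adj_natr x x' y (f : Hom x' x) (h : Hom (L x) y) :
  adj A (h ** fmap L f) = adj A h ** f.
Proof. by have := adj_nat A f (idc y) h; rewrite fmap1 !comp1c. Qed.

Lemma adj_inv_natl x y y' (g : Hom y y') (h : Hom x (R y)) :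
  adj_inv A (fmap R g ** h) = g ** adj_inv A h.
Proof. by apply: (can_inj (@adjK _ _ _ _ A _ _)); rewrite adj_natl !adj_invK. Qed.

Lemma adj_inv_natr x x' y (f : Hom x' x) (h : Hom x (R y)) :
  adj_inv A (h ** f) = adj_inv A h ** fmap L f.
Proof. by apply: (can_inj (@adjK _ _ _ _ A _ _)); rewrite adj_natr !adj_invK. Qed.

(** This replaces the explicit calculation of limits of sheaves: each half of an
    equivalence is a right adjoint of the other half. *)
Lemma right_adjoint_lex : preserves_finite_limits R.
Proof.
move=> J G a p _ [pcone plim]; split=> [i j u|b q qcone] /=.
  by rewrite -fmapM pcone.
have [|h [hp hU]] := plim (L b) (fun j => adj_inv A (q j)).
  by move=> i j u; rewrite -adj_inv_natl; congr adj_inv; apply: qcone.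
exists (adj A h); split=> [j|k kp].
  by rewrite -adj_natl hp adj_invK.
rewrite (hU (adj_inv A k)) ?adj_invK// => j.
by rewrite -adj_inv_natl; congr adj_inv; apply: kp.
Qed.

End adjunction_theory.

Definition is_iso (C : category) (x y : C) (f : Hom x y) : Prop :=
  exists g : Hom y x, g ** f = idc x /\ f ** g = idc y.

Section adjoint_equivalence.
Variables (C D : category) (L : functor C D) (R : functor D C).
Variable A : adjunction L R.

Let unit x : Hom x (R (L x)) := adj A (idc (L x)).
Let counit y : Hom (L (R y)) y := adj_inv A (idc (R y)).

Hypothesis unit_iso : forall x, is_iso (unit x).
Hypothesis counit_iso : forall y, is_iso (counit y).

Let uinv x : Hom (R (L x)) x := sval (cid (unit_iso x)).
Let cinv y : Hom y (L (R y)) := sval (cid (counit_iso y)).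

Let uinvK x : uinv x ** unit x = idc x.
Proof. by rewrite /uinv; case: cid => ? []. Qed.
Let unitK x : unit x ** uinv x = idc _.
Proof. by rewrite /uinv; case: cid => ? []. Qed.
Let cinvK y : cinv y ** counit y = idc _.
Proof. by rewrite /cinv; case: cid => ? []. Qed.
Let counitK y : counit y ** cinv y = idc y.
Proof. by rewrite /cinv; case: cid => ? []. Qed.

Let unit_nat x x' (f : Hom x x') :
  unit x' ** f = fmap R (fmap L f) ** unit x.
Proof. by rewrite -adj_natr comp1c -adj_natl compc1. Qed.

Let counit_nat y y' (g : Hom y y') :
  g ** counit y = counit y' ** fmap L (fmap R g).
Proof. by rewrite -adj_inv_natr comp1c -adj_inv_natl compc1. Qed.

Let uinv_nat x x' (f : Hom x x') :
  f ** uinv x = uinv x' ** fmap R (fmap L f).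
Proof.
rewrite -[RHS]compc1 -(unitK x) compcA -(compcA (uinv x')) -unit_nat.
by rewrite compcA uinvK comp1c.
Qed.

Let cinv_nat y y' (g : Hom y y') :
  cinv y' ** g = fmap L (fmap R g) ** cinv y.
Proof.
rewrite -[LHS]compc1 -(counitK y) compcA -(compcA (cinv y')) counit_nat.
by rewrite compcA cinvK comp1c.
Qed.

Let triangleR y : fmap R (counit y) ** unit (R y) = idc (R y).
Proof. by rewrite -adj_natl compc1 adj_invK. Qed.

Let triangleL x : counit (L x) ** fmap L (unit x) = idc (L x).
Proof. by rewrite -adj_inv_natr comp1c adjK. Qed.

Let uinv_R y : uinv (R y) = fmap R (counit y).
Proof. by rewrite -[RHS]compc1 -(unitK (R y)) compcA triangleR comp1c. Qed.

Let fmap_uinv x : fmap L (uinv x) = counit (L x).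
Proof.
by rewrite -[LHS]comp1c -triangleL -compcA -fmapM unitK fmap1 compc1.
Qed.

Let flip y x (g : Hom (R y) x) : Hom y (L x) := fmap L g ** cinv y.
Let flip_inv y x (h : Hom y (L x)) : Hom (R y) x := uinv x ** fmap R h.

Let flipK y x : cancel (@flip y x) (@flip_inv y x).
Proof.
move=> g; rewrite /flip_inv /flip fmapM compcA -uinv_nat uinv_R -compcA.
by rewrite -fmapM counitK fmap1 compc1.
Qed.

Let flip_invK y x : cancel (@flip_inv y x) (@flip y x).
Proof.
move=> h; rewrite /flip_inv /flip fmapM -compcA -cinv_nat compcA.
by rewrite fmap_uinv counitK comp1c.
Qed.

(** The inverses of the unit and the counit of an adjoint equivalence are the
    counit and the unit of the adjunction in the other direction. *)
Definition adjunction_flip : adjunction R L.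
Proof.
apply: (Adjunction flipK flip_invK) => y y' x x' f g h.
by rewrite /flip !fmapM -!compcA cinv_nat.
Defined.

Let L_faithful : faithful L.
Proof.
move=> x x' f g fg.
by rewrite -[f]comp1c -[g]comp1c -(uinvK x') -!compcA !unit_nat fg.
Qed.

Let R_faithful : faithful R.
Proof.
move=> y y' f g fg.
by rewrite -[f]compc1 -[g]compc1 -(counitK y) !compcA !counit_nat fg.
Qed.

Lemma equivalence_gm : exists f : geometric_morphism D C, surjective_gm f.
Proof.
by exists (GeometricMorphism A (right_adjoint_lex adjunction_flip)).
Qed.

Lemma equivalence_gm_inv : exists f : geometric_morphism C D, surjective_gm f.
Proof.
by exists (GeometricMorphism adjunction_flip (right_adjoint_lex A)).
Qed.

End adjoint_equivalence.

Section gm_comp.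
Variables (E F G : category).
Variables (f : geometric_morphism E F) (g : geometric_morphism F G).

Let invf := inverse_image f.
Let invg := inverse_image g.
Let dirf := direct_image f.
Let dirg := direct_image g.

Definition gm_comp_adj :
  adjunction (functor_comp invf invg) (functor_comp dirg dirf).
Proof.
unshelve refine (@Adjunction _ _ (functor_comp invf invg)
  (functor_comp dirg dirf)
  (fun x y h => adj (gm_adj g) (@adj _ _ _ _ (gm_adj f) (invg x) y h))
  (fun x y h => adj_inv (gm_adj f) (@adj_inv _ _ _ _ (gm_adj g) x (dirf y) h))
  _ _ _).
- by move=> x y h /=; rewrite !adjK.
- by move=> x y h /=; rewrite !adj_invK.
- by move=> x x' y y' u v h /=; rewrite !adj_nat.
Defined.

Lemma gm_comp_lex : preserves_finite_limits (functor_comp invf invg).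
Proof.
move=> J D a p Jfin plim.
exact: (gm_lex f Jfin (gm_lex g Jfin plim)).
Qed.

Definition gm_comp : geometric_morphism E G :=
  GeometricMorphism gm_comp_adj gm_comp_lex.

End gm_comp.

Lemma surjective_gm_trans (E F G : category) :
  (exists f : geometric_morphism E F, surjective_gm f) ->
  (exists g : geometric_morphism F G, surjective_gm g) ->
  exists h : geometric_morphism E G, surjective_gm h.
Proof.
move=> [f fs] [g gs]; exists (gm_comp f g) => x y u v uv.
exact/gs/fs.
Qed.

(** * Presheaves *)

Definition component (C : category) (F G : PSh C) (f : Hom F G) (u : C) :
  fobj F u -> fobj G u := ntr f u.

Section presheaf_theory.
Variable C : category.
Implicit Types (F G H : PSh C) (u v w : C).

Lemma restrict1 F u (s : fobj F u) : restrict (idc u) s = s.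
Proof. exact: (congr1 (@^~ s) (fmap1 F u)). Qed.

Lemma restrictM F u v w (f : Hom v u) (g : Hom w v) (s : fobj F u) :
  restrict (f ** g) s = restrict g (restrict f s).
Proof. exact: (congr1 (@^~ s) (@fmapM _ _ F u v w g f)). Qed.

Lemma component_restrict F G (a : Hom F G) u v (f : Hom v u) (s : fobj F u) :
  component a (restrict f s) = restrict f (component a s).
Proof. exact: (congr1 (@^~ s) (@ntr_nat _ _ _ _ a u v f)). Qed.

Lemma component1 F u (s : fobj F u) : component (idc F) s = s.
Proof. by []. Qed.

Lemma componentM F G H (b : Hom G H) (a : Hom F G) u (s : fobj F u) :
  component (b ** a) s = component b (component a s).
Proof. by []. Qed.

Lemma presheaf_hom_eq F G (a b : Hom F G) :
  (forall u s, component (u := u) a s = component b s) -> a = b.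
Proof. by move=> ab; apply: nat_trans_eq => u; apply/funext => s; apply: ab. Qed.

Lemma presheaf_homP F G (phi : forall u : C, fobj F u -> fobj G u) :
  (forall u v (f : Hom v u) s, phi v (restrict f s) = restrict f (phi u s)) ->
  exists a : Hom F G, forall u s, component (u := u) a s = phi u s.
Proof.
move=> phi_nat.
unshelve refine (ex_intro _ (@NatTrans _ _ F G phi _) _) => //.
by move=> u v f; apply/funext => s; apply: phi_nat.
Qed.

Lemma presheaf_iso F G (a : Hom F G) :
  (forall u (t : fobj G u), exists! s, component a s = t) -> is_iso a.
Proof.
move=> abij.
pose b u t := sval (cid (abij u t)).
have bP u t : component a (b u t) = t by rewrite /b; case: (cid (abij u t)) => s [].
have bU u s t : component a s = t -> b u t = s.
  by move=> st; rewrite /b; case: (cid (abij u t)) => s' /= [_ sU]; apply: sU.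
have [|b' b'P] := @presheaf_homP G F b.
  by move=> u v f s; apply: bU; rewrite component_restrict bP.
exists b'; split; apply: presheaf_hom_eq => u s.
  by rewrite componentM component1 b'P; apply: bU.
by rewrite componentM component1 b'P bP.
Qed.

End presheaf_theory.

(** Representable presheaves and Kan extensions take values in types that quantify
    over objects and arrows. For an arbitrary [category] such a type lies in a
    universe above the one of [set_category]; the fields [sobj] and [shom] live
    in universes of their own, which can be placed below it. *)
Record small_category := SmallCategory {
  sobj : Type;
  shom : sobj -> sobj -> Type;
  sid : forall x, shom x x;
  scomp : forall x y z, shom y z -> shom x y -> shom x z;
  scomp1 : forall x y (f : shom x y), scomp f (sid x) = f;
  scomp1c : forall x y (f : shom x y), scomp (sid y) f = f;
  scompA : forall x y z t (h : shom z t) (g : shom y z) (f : shom x y),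
    scomp h (scomp g f) = scomp (scomp h g) f
}.

Coercion category_of_small (A : small_category) : category :=
  Category (@scomp1 A) (@scomp1c A) (@scompA A).

Section representable.
Variable A : small_category.

Definition representable (a : A) : PSh A.
Proof.
unshelve refine (@Functor (op_category A) set_category
  (fun b => @shom A b a) (fun b c (f : @Hom A c b) (h : @Hom A b a) => h ** f) _ _).
- by move=> b; apply/funext => h; apply: (@compc1 A).
- by move=> b c d g f; apply/funext => h; apply: (@compcA A).
Defined.

Definition yoneda (a : A) (X : PSh A) (x : fobj X a) : Hom (representable a) X.
Proof.
unshelve refine (@NatTrans _ _ (representable a) X
  (fun b (h : @Hom A b a) => restrict h x) _).
by move=> b c f; apply/funext => h; apply: restrictM.
Defined.

Lemma component_yoneda (a : A) (X : PSh A) (x : fobj X a) b (h : @Hom A b a) :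
  component (yoneda x) (h : fobj (representable a) b) = restrict h x.
Proof. by []. Qed.

(** By the Yoneda lemma, compatible elements of the values at [a] form a cone over
    the representable presheaf of [a], and the mediating arrow is an element. *)
Lemma limit_pointwise (J : category) (D : functor J (PSh A)) (X : PSh A)
    (p : forall j, Hom X (D j)) (a : A) (x : forall j, fobj (D j) a) :
  is_limit p ->
  (forall i j (k : Hom i j), component (fmap D k) (x i) = x j) ->
  exists! y : fobj X a, forall j, component (p j) y = x j.
Proof.
move=> [_ plim] xcone.
have [|h [hp hU]] := plim (representable a) (fun j => yoneda (x j)).
  move=> i j k; apply: presheaf_hom_eq => b f.
  by rewrite componentM component_yoneda component_restrict xcone.
exists (component (u := a) h (idc a)); split=> [j|y yx].
  have := congr1 (fun m : Hom (representable a) (D j) => component (u := a) m (idc a)) (hp j).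
  by rewrite componentM component_yoneda restrict1.
rewrite (hU (yoneda y)) ?component_yoneda ?restrict1 // => j.
apply: presheaf_hom_eq => b f.
by rewrite componentM !component_yoneda component_restrict yx.
Qed.

End representable.

(** * Kan extensions of presheaves *)

Section precomposition.
Variables (A B : small_category) (u : functor A B).

Definition precomp_presheaf (X : PSh B) : PSh A.
Proof.
unshelve refine (@Functor (op_category A) set_category
  (fun a => fobj X (u a)) (fun a b (f : @Hom A b a) => restrict (fmap u f)) _ _).
- by move=> a; apply/funext => x; rewrite (fmap1 u) restrict1.
- by move=> a b c g f; apply/funext => x; rewrite (@fmapM _ _ u) restrictM.
Defined.

Definition precomp_hom (X Y : PSh B) (f : Hom X Y) :
  Hom (precomp_presheaf X) (precomp_presheaf Y).
Proof.
unshelve refine (@NatTrans _ _ (precomp_presheaf X) (precomp_presheaf Y)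
  (fun a => component (u := u a) f) _).
by move=> a b h; apply/funext => x; exact: (component_restrict f (fmap u h) x).
Defined.

Definition precomp : functor (PSh B) (PSh A).
Proof.
unshelve refine (@Functor (PSh B) (PSh A) precomp_presheaf precomp_hom _ _).
- by move=> X; apply: presheaf_hom_eq.
- by move=> X Y Z g f; apply: presheaf_hom_eq.
Defined.

(** The value at [b] of the right Kan extension of [F] along [u], as a limit over
    the comma category of arrows from [u] to [b]. *)
Record ran_family (F : PSh A) (b : sobj B) := RanFamily {
  ran_val : forall a : sobj A, @shom B (u a) b -> fobj F a;
  ran_val_nat : forall (a a' : A) (k : Hom a' a) (h : @Hom B (u a) b),
    restrict k (ran_val h) = ran_val (h ** fmap u k)
}.

Lemma ran_family_eq F b (y z : ran_family F b) :
  (forall a (h : @Hom B (u a) b), ran_val y h = ran_val z h) -> y = z.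
Proof.
case: y z => [y yn] [z zn] /= yz.
have {}yz : y = z.
  by apply: functional_extensionality_dep => a; apply/funext => h; apply: yz.
by case: _ / yz zn => zn; congr RanFamily; apply: Prop_irrelevance.
Qed.

Definition ran_restrict F b c (f : @Hom B c b) (y : ran_family F b) :
  ran_family F c.
Proof.
unshelve refine (@RanFamily F c
  (fun a (h : @Hom B (u a) c) => ran_val y (f ** h)) _).
by move=> a a' k h; rewrite ran_val_nat compcA.
Defined.

Definition ran_presheaf (F : PSh A) : PSh B.
Proof.
unshelve refine (@Functor (op_category B) set_category
  (ran_family F) (@ran_restrict F) _ _).
- move=> b; apply/funext => y; apply: ran_family_eq => a h.
  exact: (congr1 (@ran_val F b y a) (@comp1c B _ _ h)).
- move=> b c d g f; apply/funext => y; apply: ran_family_eq => a h.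
  exact: (congr1 (@ran_val F b y a) (esym (@compcA B _ _ _ _ f g h))).
Defined.

Definition ran_map (F G : PSh A) (f : Hom F G) b (y : ran_family F b) :
  ran_family G b.
Proof.
unshelve refine (@RanFamily G b
  (fun a (h : @Hom B (u a) b) => component f (ran_val y h)) _).
by move=> a a' k h; rewrite -component_restrict ran_val_nat.
Defined.

Definition ran_hom (F G : PSh A) (f : Hom F G) :
  Hom (ran_presheaf F) (ran_presheaf G).
Proof.
unshelve refine (@NatTrans _ _ (ran_presheaf F) (ran_presheaf G) (ran_map f) _).
by move=> b c h; apply/funext => y; apply: ran_family_eq.
Defined.

Definition ran : functor (PSh A) (PSh B).
Proof.
unshelve refine (@Functor (PSh A) (PSh B) ran_presheaf ran_hom _ _).
- by move=> F; apply: presheaf_hom_eq => b y; apply: ran_family_eq.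
- by move=> F G H g f; apply: presheaf_hom_eq => b y; apply: ran_family_eq.
Defined.

Definition ran_transpose (X : PSh B) (F : PSh A) (f : Hom (precomp X) F) :
  Hom X (ran F).
Proof.
unshelve refine (@NatTrans _ _ X (ran_presheaf F)
  (fun b x => @RanFamily F b
     (fun a (h : @Hom B (u a) b) =>
        component f (restrict h x : fobj (precomp X) a)) _) _).
  by move=> a a' k h; rewrite -component_restrict restrictM.
move=> b c g; apply/funext => x; apply: ran_family_eq => a h.
exact: (congr1 (@component _ (precomp X) F f a) (esym (@restrictM B X b c (u a) g h x))).
Defined.

Definition ran_untranspose (X : PSh B) (F : PSh A) (f : Hom X (ran F)) :
  Hom (precomp X) F.
Proof.
unshelve refine (@NatTrans _ _ (precomp X) F
  (fun a x => ran_val (component (u := u a) f x) (@idc B (u a))) _).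
move=> a b h; apply/funext => x.
set y : ran_family F (u a) := component (u := u a) f x.
transitivity (ran_val y (fmap u h)).
  rewrite -[RHS](congr1 (@ran_val F (u a) y b) (@compc1 B _ _ (fmap u h))).
  exact: (congr1 (fun z => @ran_val F (u b) z b (@idc B (u b)))
    (component_restrict f (fmap u h) x)).
rewrite -[LHS](congr1 (@ran_val F (u a) y b) (@comp1c B _ _ (fmap u h))).
exact: (esym (ran_val_nat y h (@idc B (u a)))).
Defined.

Definition ran_adj : adjunction precomp ran.
Proof.
apply: (@Adjunction _ _ precomp ran ran_transpose ran_untranspose).
- move=> X F f; apply: presheaf_hom_eq => a x.
  by rewrite /component /= restrict1.
- move=> X F f; apply: presheaf_hom_eq => b x; apply: ran_family_eq => a h.
  rewrite /= component_restrict.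
  exact: (congr1 (@ran_val F b (component f x) a) (@compc1 B _ _ h)).
- move=> X X' F F' f g h; apply: presheaf_hom_eq => b x.
  apply: ran_family_eq => a k /=.
  by rewrite /component /= -component_restrict.
Defined.

(** A mediating map is constructed objectwise: limits of presheaves are pointwise,
    and naturality follows from uniqueness at each object. *)
Lemma precomp_lex : preserves_finite_limits precomp.
Proof.
move=> J D X p _ plim; split=> [i j k|Y q qcone].
  by rewrite -[LHS]/(fmap precomp (fmap D k) ** fmap precomp (p i))
    -(@fmapM _ _ precomp) plim.1.
have lift (a : A) (y : fobj Y a) : exists! x : fobj X (u a),
    forall j, component (p j) x = component (q j) y.
  apply: (limit_pointwise (a := u a) (x := fun j => component (q j) y) plim).
  by move=> i j k; rewrite -(qcone i j k).
pose h (a : A) y := sval (cid (lift a y)).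
have hP a y j : component (p j) (h a y) = component (q j) y.
  by rewrite /h; case: (cid (lift a y)) => x /= [].
have hU a y x : (forall j, component (p j) x = component (q j) y) -> h a y = x.
  by move=> xy; rewrite /h; case: (cid (lift a y)) => x' /= [_ xU]; apply: xU.
have [|h' h'P] := @presheaf_homP A Y (precomp X) h.
  move=> a b f y; apply: hU => j.
  rewrite component_restrict -hP.
  exact: component_restrict.
exists h'; split=> [j|k kP].
  by apply: presheaf_hom_eq => a y; rewrite componentM h'P -hP.
apply: presheaf_hom_eq => a y; rewrite h'P; apply: hU => j.
by rewrite -(kP j).
Qed.

Lemma precomp_gm : (forall b : B, exists a : A, u a = b) ->
  exists f : geometric_morphism (PSh A) (PSh B), surjective_gm f.
Proof.
move=> usurj; exists (GeometricMorphism ran_adj precomp_lex) => X Y f g fg.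
apply: presheaf_hom_eq => b; have [a <-] := usurj b => x.
exact: (congr1 (fun k : Hom (precomp X) (precomp Y) => component (u := a) k x) fg).
Qed.

End precomposition.

(** * Sites generated by irreducible objects *)

Section full_on.
Variables (T : small_category) (P : Type) (p : P -> sobj T).

Definition full_on : small_category := {|
  sobj := P;
  shom := fun a b => @shom T (p a) (p b);
  sid := fun a => @sid T (p a);
  scomp := fun _ _ _ g f => @scomp T _ _ _ g f;
  scomp1 := fun _ _ f => @scomp1 T _ _ f;
  scomp1c := fun _ _ f => @scomp1c T _ _ f;
  scompA := fun _ _ _ _ h g f => @scompA T _ _ _ _ h g f
|}.

Definition full_on_inclusion : functor full_on T :=
  @Functor full_on T p (fun _ _ f => f) (fun _ => erefl) (fun _ _ _ _ _ => erefl).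

(** An inductive family, so that a member of the presieve has the object [p a]
    itself as domain and no transport along an equality of objects is needed. *)
Inductive points_presieve (u : T) : presieve u :=
  PointsPresieve (a : P) (h : @Hom T (p a) u) : points_presieve h.

End full_on.

Section comparison.
Variables (T : small_category) (K : forall u : T, presieve u -> Prop).
Variables (P : Type) (p : P -> sobj T).

Hypothesis point_irreducible : forall (u : T) (A : presieve u), K A ->
  forall a (h : @Hom T (p a) u),
  exists v (f : Hom v u) (k : @Hom T (p a) v), A v f /\ h = f ** k.
Hypothesis points_cover : forall u : T, K (@points_presieve T P p u).

Let S := @Site T K.
Let Q := full_on p.
Let i := full_on_inclusion p.

(** An element of the extension at [u] is a family indexed by the arrows from the
    points to [u]. Each of these factors through the cover, which determines the
    glued family; matching makes the choice of the factorisation irrelevant. *)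
Lemma ran_is_sheaf (X : PSh Q) : @is_sheaf S (ran i X).
Proof.
move=> u A KA x xm.
have indep a v w (f : @Hom T v u) (g : @Hom T w u) (Af : A v f) (Ag : A w g)
    (k : @Hom T (p a) v) (l : @Hom T (p a) w) : f ** k = g ** l ->
    ran_val (x v f Af) k = ran_val (x w g Ag) l.
  move=> /(xm _ _ _ _ Af Ag)
    /(congr1 (fun z : ran_family i X (p a) => ran_val z (@idc T (p a)))) kl.
  have kE := congr1 (@ran_val _ _ _ _ _ (x v f Af) a) (@compc1 T _ _ k).
  have lE := congr1 (@ran_val _ _ _ _ _ (x w g Ag) a) (@compc1 T _ _ l).
  exact: etrans (esym kE) (etrans kl lE).
have glue (a : P) (h : @Hom T (p a) u) : exists y : fobj X a,
    forall v (f : @Hom T v u) (Af : A v f) k, h = f ** k ->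
    ran_val (x v f Af) k = y.
  have [v [f [k [Af hE]]]] := point_irreducible KA h.
  exists (ran_val (x v f Af) k) => w g Ag l hE'.
  by apply: indep; rewrite -hE -hE'.
pose s a h := sval (cid (glue a h)).
have sP a h v (f : @Hom T v u) (Af : A v f) k : h = f ** k ->
    ran_val (x v f Af) k = s a h.
  by move=> hE; rewrite /s; case: (cid (glue a h)) => y /= yP; apply: yP.
have snat (a a' : Q) (k : Hom a' a) (h : @Hom T (p a) u) :
    restrict k (s a h) = s a' (h ** fmap i k).
  have [v [f [l [Af hE]]]] := point_irreducible KA h.
  rewrite -(sP _ _ _ _ Af _ hE) ran_val_nat.
  by apply: sP; rewrite hE compcA.
exists (@RanFamily _ _ i X u s snat); split=> [v f Af|y yx].
  by apply: ran_family_eq => a h; apply/esym/sP.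
apply: ran_family_eq => a h.
have [v [f [k [Af hE]]]] := point_irreducible KA h.
by rewrite /= -(sP _ _ _ _ Af _ hE) -yx hE.
Qed.

Definition restrict_to_points : functor (Sh S) (PSh Q).
Proof.
unshelve refine (@Functor (Sh S) (PSh Q) (fun F => precomp i (sval F))
  (fun F G f => fmap (precomp i) f) _ _).
- by move=> F; apply: (fmap1 (precomp i)).
- by move=> F G H g f; apply: (@fmapM _ _ (precomp i)).
Defined.

Definition extend_from_points : functor (PSh Q) (Sh S).
Proof.
unshelve refine (@Functor (PSh Q) (Sh S)
  (fun X => exist _ (ran i X) (@ran_is_sheaf X)) (fun X Y f => fmap (ran i) f) _ _).
- by move=> X; apply: (fmap1 (ran i)).
- by move=> X Y Z g f; apply: (@fmapM _ _ (ran i)).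
Defined.

Definition points_adj : adjunction restrict_to_points extend_from_points.
Proof.
exact: (@Adjunction (Sh S) (PSh Q) restrict_to_points extend_from_points
  (fun F X => @adj _ _ _ _ (ran_adj i) (sval F) X)
  (fun F X => @adj_inv _ _ _ _ (ran_adj i) (sval F) X)
  (fun F X => @adjK _ _ _ _ (ran_adj i) (sval F) X)
  (fun F X => @adj_invK _ _ _ _ (ran_adj i) (sval F) X)
  (fun F F' X X' => @adj_nat _ _ _ _ (ran_adj i) (sval F) (sval F') X X')).
Defined.

Lemma sheaf_separated (F : Sh S) (u : T) (s t : fobj (sval F) u) :
  (forall a (h : @Hom T (p a) u), restrict h s = restrict h t) -> s = t.
Proof.
move=> st; case: F s t st => /= F Fsh s t st.
have [|r [_ rU]] := Fsh u _ (points_cover u) (fun v f _ => restrict f s).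
  by move=> v w f g _ _ z h k fg; rewrite -!(@restrictM T) fg.
rewrite -(rU s) // (rU t) // => v f [a h].
exact/esym/st.
Qed.

(** On an object of the cover by points, through which an arrow to [u] factors, the
    family already has a value; the sheaf condition glues these values. *)
Lemma sheaf_glue (F : Sh S) (u : T) (y : ran_family i (precomp i (sval F)) u) :
  exists s : fobj (sval F) u,
  forall a (h : @Hom T (p a) u), restrict h s = ran_val y h.
Proof.
have local v (f : @Hom T v u) : points_presieve p f -> exists z : fobj (sval F) v,
    forall a (k : @Hom T (p a) v), restrict k z = ran_val y (f ** k).
  case=> a h; exists (ran_val y h) => a' k.
  exact: (@ran_val_nat _ _ i _ _ y a a' k h).
pose x v f Af := sval (cid (local v f Af)).
have xP v f Af a (k : @Hom T (p a) v) :
    restrict k (x v f Af) = ran_val y (f ** k).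
  by rewrite /x; case: (cid (local v f Af)) => z /= zP; apply: zP.
have [|s [sx _]] := proj2_sig F u _ (points_cover u) x.
  move=> v w f g Af Ag z h k fg; apply: sheaf_separated => a l.
  by rewrite -!(@restrictM T) !xP !compcA fg.
exists s => a h.
have := sx _ _ (PointsPresieve h) => ->.
by rewrite -[LHS](@restrict1 T) xP compc1.
Qed.

(** The unit sends a section to the family of its restrictions to points. *)
Lemma points_unit_iso (F : Sh S) :
  is_iso (adj points_adj (idc (restrict_to_points F))).
Proof.
apply: (@presheaf_iso T (sval F)) => u y.
have [s sy] := sheaf_glue y.
exists s; split=> [|t ty].
  by apply: ran_family_eq => a h; apply: sy.
by apply: sheaf_separated => a h; rewrite sy -ty.
Qed.

(** The counit evaluates a family at the identity of a point, and a family over a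
    point is determined by this value. *)
Lemma points_counit_iso (X : PSh Q) :
  is_iso (adj_inv points_adj (idc (extend_from_points X))).
Proof.
apply: presheaf_iso => a x.
pose y := @RanFamily _ _ i X (p a) (fun b (h : @Hom Q b a) => restrict h x)
  (fun b b' k h => esym (@restrictM Q X a b b' h k x)).
exists y; split=> [|z zx]; first exact: restrict1.
apply: ran_family_eq => b h /=; rewrite -zx.
rewrite (@ran_val_nat _ _ i X _ z a b h (@idc T (p a))).
by congr ran_val; apply: (@comp1c T).
Qed.

Lemma site_to_points_gm :
  exists f : geometric_morphism (Sh S) (PSh Q), surjective_gm f.
Proof. exact: equivalence_gm_inv points_unit_iso points_counit_iso. Qed.

Lemma points_to_site_gm :
  exists f : geometric_morphism (PSh Q) (Sh S), surjective_gm f.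
Proof. exact: equivalence_gm points_unit_iso points_counit_iso. Qed.

End comparison.

(** * The supernatural numbers and the power of two *)

(** The same data as [preorder_category], so that the category underlying
    [small_opens] or [small_locale] is convertible to the one of the site of
    opens or of the locale; likewise for [small_monoid]. *)
Definition small_preorder (T : Type) (le : T -> T -> Prop)
    (le_refl : forall x, le x x)
    (le_trans : forall x y z, le y z -> le x y -> le x z) : small_category := {|
  sobj := T;
  shom := le;
  sid := le_refl;
  scomp := le_trans;
  scomp1 := fun _ _ _ => Prop_irrelevance _ _;
  scomp1c := fun _ _ _ => Prop_irrelevance _ _;
  scompA := fun _ _ _ _ _ _ _ => Prop_irrelevance _ _
|}.

Definition small_opens (X : topologicalType) : small_category :=
  @small_preorder (opens X) (fun U V => open_set U `<=` open_set V)
    (fun U => @subset_refl X U) (fun U V W VW UV => subset_trans UV VW).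

Definition small_locale (d : Order.disp_t) (B : porderType d) : small_category :=
  @small_preorder B (fun x y => (x <= y)%O)
    (fun x => Order.POrderTheory.lexx x)
    (fun x y z yz xy => Order.POrderTheory.le_trans xy yz).

Definition small_monoid (M : monoidType) : small_category := {|
  sobj := unit;
  shom := fun _ _ => M;
  sid := fun _ => 1%g;
  scomp := fun _ _ _ (n m : M) => (n * m)%g;
  scomp1 := fun _ _ (m : M) => mulg1 m;
  scomp1c := fun _ _ (m : M) => mul1g m;
  scompA := fun _ _ _ _ (l n m : M) => mulgA l n m
|}.

Lemma supernat_dvd_refl s : supernat_dvd s s.
Proof. by move=> p; case: (s p) => /=. Qed.

Lemma supernat_dvd_trans s t r :
  supernat_dvd s t -> supernat_dvd t r -> supernat_dvd s r.
Proof.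
move=> st tr p; move: (st p) (tr p).
by case: (s p) (t p) (r p) => [i|] [j|] [k|] //=; apply: leq_trans.
Qed.

(** Divisibility of integers is tested on valuations, prime by prime. *)
Lemma supernat_dvd_of (m n : posnat) :
  supernat_dvd (supernat_of m) (supernat_of n) -> val m %| val n.
Proof.
move=> mn; apply/dvdn_partP => [|p]; first exact: valP m.
rewrite mem_primes => /andP[p_prime _].
rewrite p_part pfactor_dvdn ?(valP n) //.
exact: (mn (exist _ p p_prime)).
Qed.

Definition principal_ideal (n : posnat) : ideal.
Proof.
apply: (@Ideal [set m : posnat | val n %| val m]) => m k /= nm.
exact: dvdn_mulr.
Defined.

Lemma dvd_open_subproof (n : posnat) :
  open [set s : supernatural | supernat_dvd (supernat_of n) s].
Proof.
exists (principal_ideal n) => //; apply/seteqP; split=> s.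
  move=> [m /= nm ms]; apply: supernat_dvd_trans ms => p /=.
  by apply: dvdn_leq_log => //; apply: valP m.
by move=> ns; exists n => //=.
Qed.

Definition dvd_open (n : posnat) : opens supernatural :=
  Opens (dvd_open_subproof n).

(** An open set is closed under supernatural multiples. *)
Lemma dvd_open_subset (n : posnat) (U : opens supernatural) :
  open_set U (supernat_of n) -> open_set (dvd_open n) `<=` open_set U.
Proof.
case: U => U /= [I _ <-] [m Im mn] s ns; exists m => //.
exact: supernat_dvd_trans mn ns.
Qed.

Definition dvd_opens := full_on (T := small_opens supernatural) dvd_open.

Lemma dvd_open_gms :
  (exists f : geometric_morphism (Sh (space_site supernatural)) (PSh dvd_opens),
    surjective_gm f) /\
  (exists f : geometric_morphism (PSh dvd_opens) (Sh (space_site supernatural)),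
    surjective_gm f).
Proof.
have irr (U : small_opens supernatural) (A : @presieve (opens_category _) U) :
    @covers (space_site supernatural) U A ->
    forall n (h : @Hom (small_opens supernatural) (dvd_open n) U),
    exists V (f : @Hom (small_opens supernatural) V U)
      (k : @Hom (small_opens supernatural) (dvd_open n) V), A V f /\ h = f ** k.
  move=> /= AU n nU.
  have Un : open_set U (supernat_of n) by apply/nU/supernat_dvd_refl.
  have /seteqP[_ /(_ _ Un)[V /= [VU AV] Vn]] := AU.
  exists V, VU, (dvd_open_subset Vn); split=> //.
have cov (U : small_opens supernatural) : @covers (space_site supernatural) U
    (@points_presieve (small_opens supernatural) posnat dvd_open U).
  apply/seteqP; split=> s; first by move=> [V [VU _]]; apply: VU.
  move=> Us; have [I _ UI] := open_setP U.
  have /seteqP[IU /(_ _ Us)[n In ns]] := UI.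
  have nU : open_set (dvd_open n) `<=` open_set U.
    apply: dvd_open_subset; apply: IU.
    by exists n => //; apply: supernat_dvd_refl.
  by exists (dvd_open n) => //; exists nU; apply: PointsPresieve.
split.
- exact: (site_to_points_gm irr cov).
- exact: (points_to_site_gm irr cov).
Qed.

Lemma two_power_le (T : Type) (f g : two_power T) :
  (f <= g)%O <-> forall t, f t -> g t.
Proof.
split=> [/lefP fg t|fg]; first by have := fg t; case: (f t) (g t) => [] [].
by apply/lefP => t; have := fg t; case: (f t) (g t) => [] [] // /(_ isT).
Qed.

Section atoms.
Variable T : Type.
Let B := two_power T.
Let L := small_locale B.

Definition atom (t : T) : B := fun t' => `[< t = t' >].

Lemma atom_le t (f : B) : (atom t <= f)%O <-> f t.
Proof.
split=> [/two_power_le|ft]; first by apply; apply/asboolP.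
by apply/two_power_le => t' /asboolP <-.
Qed.

Lemma atom_gm :
  exists f : geometric_morphism (Sh (locale_site B)) (PSh (full_on (T := L) atom)),
    surjective_gm f.
Proof.
apply: (@site_to_points_gm L (@covers (locale_site B))).
  move=> f A [Af Amin] t tf.
  have /atom_le ft := tf.
  have [[g [[gf Ag] gt]]|noA] :=
    pselect (exists g, (exists gf : (g <= f)%O, A g gf) /\ g t).
  - exists g, gf; have /atom_le tg := gt; exists tg; split=> //.
    exact: (@Prop_irrelevance (atom t <= f)%O).
  (* If no member of the cover contains t, then f deprived of t is still an
     upper bound, which contradicts the minimality of f. *)
  pose g : B := fun t' => f t' && ~~ atom t t'.
  have : (f <= g)%O.
    apply: Amin => h hA; have [hf _] := hA.
    apply/two_power_le => t' ht'; apply/andP; split.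
      by move/two_power_le: hf; apply.
    apply/negP => /asboolP tt'; apply: noA; exists h; split=> //.
    by rewrite tt'.
  move=> /two_power_le/(_ t ft)/andP[_ /negP]; case.
  exact/asboolP.
move=> f; split=> [g [gf _] //|g gA].
apply/two_power_le => t /atom_le tf; apply/atom_le.
by apply: gA; exists tf; apply: PointsPresieve.
Qed.

End atoms.

Lemma monotone_gm (A B : small_category) (u : sobj A -> sobj B)
    (umono : forall a b, @shom A a b -> @shom B (u a) (u b)) :
  (forall a b (f g : @shom B a b), f = g) ->
  (forall b, exists a, u a = b) ->
  exists f : geometric_morphism (PSh A) (PSh B), surjective_gm f.
Proof.
move=> thin; apply: (@precomp_gm A B
  (@Functor A B u umono (fun _ => thin _ _ _ _) (fun _ _ _ _ _ => thin _ _ _ _))).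
Qed.

(** Junk value 1 when the quotient vanishes; it is only used when [m] divides [n]. *)
Definition quotient (n m : posnat) : posnat := insubd (1%g : posnat) (val n %/ val m).

Lemma val_quotient (n m : posnat) :
  val m %| val n -> val (quotient n m) = val n %/ val m.
Proof.
move=> mn; rewrite /quotient val_insubd divn_gt0 ?(valP m) //.
by rewrite dvdn_leq ?(valP n).
Qed.

Lemma dvd_open_dvdn (n m : posnat) :
  @Hom dvd_opens n m -> val m %| val n.
Proof. by move=> nm; apply/supernat_dvd_of/nm/supernat_dvd_refl. Qed.

(** An arrow from [n] to [m] is an inclusion of opens, that is, a proof that [m]
    divides [n]. *)
Definition quotient_functor : functor dvd_opens (small_monoid posnat).
Proof.
unshelve refine (@Functor dvd_opens (small_monoid posnat) (fun=> tt)
  (fun n m _ => quotient n m) _ _).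
- move=> n; apply: val_inj; rewrite val_quotient //= divnn.
  by rewrite (valP n).
- move=> n m k mk nm; apply: val_inj => /=.
  have {}mk := dvd_open_dvdn mk; have {}nm := dvd_open_dvdn nm.
  rewrite !val_quotient ?(dvdn_trans mk) //.
  by rewrite mulnC muln_divA // divnK.
Defined.

Theorem theorem3 :
  let B := two_power ideal in
  let C := monoid_category posnat in
  (exists f : geometric_morphism (Sh (locale_site B)) (Sh (space_site supernatural)),
     surjective_gm f) /\
  (exists g : geometric_morphism (Sh (space_site supernatural)) (PSh C),
     surjective_gm g) /\
  barr_cover B (PSh C).
Proof.
move=> B C; have [S_to_points points_to_S] := dvd_open_gms.
have BS : exists f : geometric_morphism (Sh (locale_site B))
    (Sh (space_site supernatural)), surjective_gm f.
  (* A retraction of the map that sends an integer to its principal ideal. *)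
  pose phi (I : ideal) : posnat := xget 1%g [set n | I = principal_ideal n].
  have phiK n : phi (principal_ideal n) = n.
    apply: xget_unique => // m nm; apply/val_inj/eqP.
    have nmE (k : posnat) : val n %| val k <-> val m %| val k.
      by have /= -> := congr1 (fun I : ideal => ideal_set I k) nm.
    by rewrite eqn_dvd; apply/andP; split; apply/nmE.
  apply: surjective_gm_trans (atom_gm ideal) _.
  apply: surjective_gm_trans points_to_S.
  apply: (@monotone_gm (full_on _) dvd_opens phi) => [I J|n m f g|n].
  - by move=> /atom_le/asboolP ->.
  - exact: (@Prop_irrelevance (open_set (dvd_open n) `<=` open_set (dvd_open m))).
  - by exists (principal_ideal n).
have SC : exists g : geometric_morphism (Sh (space_site supernatural)) (PSh C),
    surjective_gm g.
  apply: surjective_gm_trans S_to_points _.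
  by apply: (precomp_gm (u := quotient_functor)) => -[]; exists 1%g.
by split=> //; split=> //; apply: surjective_gm_trans BS SC.
Qed.
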